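(* Let $(X,\operatorname{dist})$ be a compact metric space and $f\colon X\to X$ a homeomorphism. Then $f$ is expansive if and only if $f$ is partially expansive with central dimension $D=-1$.
   Context: $f$ is expansive if there is $\epsilon>0$ (an expansive constant) such that $\operatorname{dist}(f^n(x),f^n(y))<\epsilon$ for all $n\in\mathbb{Z}$ implies $x=y$. A set is non-trivial if it has more than one point. Given an integer $D\geq -1$, $f$ is partially expansive with central dimension $D$ if there is $\epsilon>0$ (an expansive constant) such that for every non-trivial compact set $C\subset X$ with $\dim(C)>D$ there is $k\in\mathbb{Z}$ with $\operatorname{diam}(f^k(C))\geq\epsilon$. Here $\dim$ is the topological (covering) dimension. *)

(* Defs.v *)
From HB Require Import structures.
From mathcomp Require Import all_boot all_order all_algebra.
From mathcomp Require Import all_classical all_reals all_analysis.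

Set Implicit Arguments.
Unset Strict Implicit.
Unset Printing Implicit Defensive.

Import Order.TTheory GRing.Theory Num.Theory.
Import numFieldTopology.Exports.

Local Open Scope classical_set_scope.
Local Open Scope ring_scope.

(* [f] ranges over total bijections carrying their inverse [f^-1]; *)
(* [Negz n] stands for the integer [- n.+1]. *)
Definition iterz (T : Type) (f : {splitbij [set: T] >-> [set: T]}) (k : int) :
    T -> T :=
  match k with
  | Posz n => iter n f
  | Negz n => iter n.+1 (f^-1)%FUN
  end.

Definition is_homeomorphism (T : topologicalType)
    (f : {splitbij [set: T] >-> [set: T]}) : Prop :=
  continuous f /\ continuous (f^-1)%FUN.

Definition open_cover (T : topologicalType) (U : set (set T)) : Prop :=
  (forall A, U A -> open A) /\ \bigcup_(A in U) A = [set: T].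

Definition refines (T : Type) (V U : set (set T)) : Prop :=
  forall B, V B -> exists2 A, U A & B `<=` A.

Definition order_le (T : Type) (V : set (set T)) (m : nat) : Prop :=
  forall x : T, ([set B | V B /\ B x] #<= `I_m)%card.

(* Lebesgue covering dimension: the least integer n >= -1 such that every open *)
(* cover has an open refinement in which each point lies in at most n + 1      *)
(* members, and +oo if there is none; here m = n + 1. The empty space has      *)
(* dimension -1.                                                               *)
Definition covering_dim (R : realType) (T : topologicalType) : \bar R :=
  ereal_inf [set (m%:R - 1)%:E | m in [set m : nat |
    forall U : set (set T), open_cover U ->
      exists V : set (set T), [/\ open_cover V, refines V U & order_le V m]]].

(* Only used on nonempty sets: the diameter of [set0] is -oo here. *)
Definition diam (R : realType) (X : metricType R) (A : set X) : \bar R :=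
  ereal_sup [set (mdist p.1 p.2)%:E | p in A `*` A].

Definition nontrivial_set (T : Type) (A : set T) : Prop :=
  exists x y, [/\ A x, A y & x <> y].

Definition expansive (R : realType) (X : metricType R)
    (f : {splitbij [set: X] >-> [set: X]}) : Prop :=
  exists2 eps : R, 0 < eps &
    forall x y : X,
      (forall n : int, mdist (iterz f n x) (iterz f n y) < eps) -> x = y.

(* Meant for D >= -1. [set_type C] carries the topology induced from X. *)
Definition partially_expansive (R : realType) (X : metricType R) (D : int)
    (f : {splitbij [set: X] >-> [set: X]}) : Prop :=
  exists2 eps : R, 0 < eps &
    forall C : set X, nontrivial_set C -> compact C ->
      ((D%:~R)%:E < covering_dim R (set_type C))%E ->
      exists k : int, (eps%:E <= diam (iterz f k @` C))%E.

(* Main.v *)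
Require Import Defs.
From mathcomp Require Import all_boot all_order all_algebra.
From mathcomp Require Import all_classical all_reals all_analysis.

Import Order.TTheory GRing.Theory Num.Theory.

Local Open Scope classical_set_scope.
Local Open Scope ring_scope.

(** Only the empty space has dimension at most [-1] ([covering_dim_ge0]), so
    partial expansivity with central dimension [-1] says that the orbit of every
    compact set with at least two points reaches diameter [eps] at some time.
    Such a set contains two distinct points, and at each time the distance of
    their images bounds the diameter from below ([mdist_le_diam]), so an
    expansive constant for points is one for compact sets. Conversely, a pair of
    distinct points is itself a non-trivial compact set, and the diameter of its
    image under an iterate is the distance of the two image points
    ([diam_image_pair]). Hence both notions hold with the same constants. *)

(** A cover with at most [0] members through each point leaves every point
    uncovered; hence a point of the space rules out the value [-1]. *)
Lemma covering_dim_ge0 (R : realType) (T : topologicalType) (x : T) :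
  (0 <= covering_dim R T)%E.
Proof.
apply: le_ereal_inf_tmp => _ [m /= dim_le <-]; rewrite lee_fin.
case: m dim_le => [dim_le|m _]; last by rewrite -natr1 addrK.
have coverT : open_cover [set [set: T]].
  by split; [move=> _ ->; exact: openT | rewrite bigcup_set1].
have [V [[_ coverV] _ ordV]] := dim_le _ coverT.
have [B VB Bx] : (\bigcup_(A in V) A) x by rewrite coverV.
have := ordV x; rewrite II0 card_le0 => /eqP V0.
by have : set0 B by rewrite -V0.
Qed.

Lemma mdist_le_diam (R : realType) (X : metricType R) (A : set X) (x y : X) :
  A x -> A y -> ((mdist x y)%:E <= diam A)%E.
Proof. by move=> Ax Ay; apply: ereal_sup_ubound; exists (x, y). Qed.

Lemma diam_image_pair (R : realType) (T : Type) (X : metricType R)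
    (g : T -> X) (x y : T) :
  diam (g @` [set x; y]) = (mdist (g x) (g y))%:E.
Proof.
apply/eqP; rewrite eq_le; apply/andP; split; last first.
  by apply: mdist_le_diam; apply: imageP; [left|right].
apply: ge_ereal_sup => _ [[_ _] [/= [u xyu <-] [v xyv <-]] <-]; rewrite lee_fin.
by case: xyu xyv => -> [] ->; rewrite ?mdistxx ?mdist_ge0 // metric_sym.
Qed.

Theorem proposition2p6 (R : realType) (X : metricType R)
    (f : {splitbij [set: X] >-> [set: X]}) :
  compact [set: X] ->
  is_homeomorphism f ->
  expansive f <-> partially_expansive (-1) f.
Proof.
move=> _ _; split=> -[eps eps_gt0 expf]; exists eps => //.
  move=> C [x [y [Cx Cy neq_xy]]] _ _; apply: contrapT => small.
  apply: neq_xy; apply: expf => n; rewrite ltNge; apply/negP => far.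
  apply: small; exists n.
  apply: (@le_trans _ _ (mdist (iterz f n x) (iterz f n y))%:E).
    by rewrite lee_fin.
  by apply: mdist_le_diam; apply: imageP.
move=> x y close; apply: contrapT => neq_xy.
have [||| k] := expf [set x; y].
- by exists x, y; split=> //; [left|right].
- by apply: compactU; exact: compact_set1.
- have xP : x \in [set x; y] by rewrite inE; left.
  apply: (@lt_le_trans _ _ 0%E); first by rewrite lte_fin ltrN10.
  exact: (@covering_dim_ge0 R (set_type [set x; y]) (SigSub xP)).
- by rewrite diam_image_pair lee_fin leNgt close.
Qed.
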